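(* Every legal move in a fractional transversal game on a hypergraph $\mathcal{H}$ can be replaced with a legal move such that each vertex occurs in at most one submove of it and the two moves result in the same load function.
   Context: A hypergraph $\mathcal{H}=(V,\mathcal{E})$ has a finite vertex set $V$ and an edge set $\mathcal{E}\subseteq 2^V\setminus\{\emptyset\}$. Fractional transversal game on $\mathcal{H}$: Edge-hitter and Staller take turns making moves and update a cover function $t:V\to[0,1]$. The corresponding load function is $\ell:\mathcal{E}\to[0,1]$, $\ell(E)=\min\{1,\sum_{v\in E}t(v)\}$. The functions after the $i$-th move are $t_i,\ell_i$; initially $t_0\equiv0$, $\ell_0\equiv0$. The game is finished when $\ell\equiv1$. As long as $\ell\not\equiv1$, the next player performs a move, which is a finite or infinite sequence of submoves $(u_1,w_1),(u_2,w_2),\dots$, where $u_k\in V$ (repetitions allowed, possibly infinitely many) and $w_k\in[0,1]$. It is required that $\sum_kw_k=1$ in each move except the last move of the game (the one after which $\ell\equiv1$), where $\sum_kw_k\le1$ suffices. The $i$-th move is legal if for every $k\ge1$ there is an edge $E\in\mathcal{E}$ with $u_k\in E$ and $\ell_{i-1}(E)+\sum_{1\le s\le k-1,\,u_s\in E}w_s+w_k\le1$. The function $t_i$ is obtained from $t_{i-1}$ by adding $w_k$ to the value at $u_k$ for every submove, and $\ell_i$ is the load function corresponding to $t_i$. *)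

(* Defs.v *)
From HB Require Import structures.
From mathcomp Require Import all_boot all_order all_algebra.
From mathcomp Require Import boolp classical_sets reals ereal topology.
From mathcomp Require Import normedtype sequences.

Set Implicit Arguments.
Unset Strict Implicit.
Unset Printing Implicit Defensive.

Import Order.TTheory GRing.Theory Num.Theory.
Local Open Scope ring_scope.

Record hypergraph (V : finType) := Hypergraph {
  edges : {set {set V}};
  edges_nonempty : finset.set0 \notin edges }.

(* A submove is a pair (vertex, amount). *)
Inductive move (R : realType) (V : finType) :=
  | FinMove of seq (V * R)
  | InfMove of (nat -> V * R).

(* Submoves are numbered from 0; [None] beyond the end of a finite move. *)
Definition submove (R : realType) (V : finType) (m : move R V) (k : nat)
    : option (V * R) :=
  match m with FinMove s => onth s k | InfMove f => Some (f k) end.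

(* Amount that the k-th submove places on the vertices of A. *)
Definition amount (R : realType) (V : finType) (m : move R V)
    (A : {pred V}) (k : nat) : R :=
  if submove m k is Some (u, w) then (if u \in A then w else 0) else 0.

(* The sum is taken in the extended reals, where it exists for nonnegative
   amounts whether or not the real series converges. *)
Definition total (R : realType) (V : finType) (m : move R V)
    (A : {pred V}) : \bar R :=
  (\sum_(0 <= k <oo) (amount m A k)%:E)%E.

(* [fine] is harmless on legal moves: there the total over all the vertices
   is at most 1. *)
Definition play (R : realType) (V : finType) (t : V -> R) (m : move R V)
    : V -> R :=
  fun v => t v + fine (total m (pred1 v)).

Definition load (R : realType) (V : finType) (t : V -> R) (E : {set V}) : R :=
  Num.min 1 (\sum_(v in E) t v).

Definition finished (R : realType) (V : finType) (H : hypergraph V)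
    (t : V -> R) : Prop :=
  forall E : {set V}, E \in edges H -> load t E = 1.

Definition valid_move (R : realType) (V : finType) (H : hypergraph V)
    (t : V -> R) (m : move R V) : Prop :=
  [/\ forall (k : nat) (u : V) (w : R),
        submove m k = Some (u, w) -> 0 <= w <= 1,
      (total m predT <= 1)%E
    & ~ finished H (play t m) -> total m predT = 1%E].

(* Moves exist only while the game is not finished.  Legality bounds
   the unclipped sum of the load before the move and the amounts placed on E
   so far in the move. *)
Definition legal_move (R : realType) (V : finType) (H : hypergraph V)
    (t : V -> R) (m : move R V) : Prop :=
  [/\ ~ finished H t,
      valid_move H t m
    & forall (k : nat) (u : V) (w : R), submove m k = Some (u, w) ->
        exists E : {set V}, [/\ E \in edges H, u \in E
          & load t E + \sum_(0 <= s < k) amount m E s + w <= 1]].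

(* The cover functions that occur in a game on H.  The two players have the
   same moves available, so whose turn it is need not be recorded. *)
Inductive game_cover (R : realType) (V : finType) (H : hypergraph V)
    : (V -> R) -> Prop :=
  | game_start : game_cover H (fun=> 0)
  | game_move (t : V -> R) (m : move R V) :
      game_cover H t -> legal_move H t m -> game_cover H (play t m).

Definition vertices_distinct (R : realType) (V : finType) (m : move R V)
    : Prop :=
  forall (j k : nat) (u : V) (w w' : R),
    submove m j = Some (u, w) -> submove m k = Some (u, w') -> j = k.

(* Cover functions are typed V -> R; legality keeps their values in [0, 1]. *)
Lemma game_cover_range (R : realType) (V : finType) (H : hypergraph V)
    (t : V -> R) (v : V) : game_cover H t -> 0 <= t v <= 1.
Proof.
move=> gt; elim: gt v => {t} [v|t m _ IH [_ [w01 _ _] leg] v].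
  by rewrite lexx ler01.
have a0 A k : 0 <= amount m A k.
  rewrite /amount; case E: (submove m k) => [[u w]|//].
  by case: ifP => // _; case/andP: (w01 _ _ _ E).
have bnd n : t v + \sum_(0 <= k < n) amount m (pred1 v) k <= 1.
  elim: n => [|n IHn].
    by rewrite big_geq // addr0; case/andP: (IH v).
  rewrite big_nat_recr //= addrA {2}/amount.
  case E: (submove m n) => [[u w]|]; last by rewrite addr0.
  case: ifP => [|_]; last by rewrite addr0.
  rewrite inE => /eqP uv; subst u.
  have [F [_ vF]] := leg _ _ _ E.
  rewrite /load; case: (leP 1 (\sum_(x in F) t x)) => [_|lt1] h.
    suff w0 : w <= 0 by rewrite -[1]addr0 lerD.
    have : 0 <= \sum_(0 <= s < n) amount m F s by apply: sumr_ge0.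
    by move=> s0; move: h; rewrite -addrA gerDl; apply: le_trans; rewrite lerDr.
  apply: le_trans h; rewrite lerD2r lerD //.
    rewrite (bigD1 v) //= lerDl sumr_ge0 // => x _.
    by case/andP: (IH x).
  apply: ler_sum => k _; rewrite /amount.
  case Ek: (submove m k) => [[x y]|//].
  case: ifP => [|_]; first by rewrite inE => /eqP ->; rewrite vF.
  by case: ifP => // _; case/andP: (w01 _ _ _ Ek).
have T0 : (0 <= total m (pred1 v))%E.
  by apply: nneseries_ge0 => k _ _; rewrite lee_fin.
have T1 : (total m (pred1 v) <= (1 - t v)%:E)%E.
  apply: lime_le.
    by apply: is_cvg_nneseries => k _ _; rewrite lee_fin.
  near=> n; rewrite sumEFin lee_fin.
  by rewrite lerBrDl.
rewrite /play; move: T0 T1; case: (total _ _) => [r| |] //=.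
rewrite !lee_fin => r0 r1; case/andP: (IH v) => t0 _.
by rewrite addr_ge0 //= -lerBrDl.
Unshelve. all: by end_near.
Qed.

(* Main.v *)
Require Import Defs.
From HB Require Import structures.
From mathcomp Require Import all_boot all_order all_algebra.
From mathcomp Require Import boolp classical_sets reals ereal topology.
From mathcomp Require Import normedtype sequences.

Set Implicit Arguments.
Unset Strict Implicit.
Unset Printing Implicit Defensive.

Import Order.TTheory GRing.Theory Num.Theory.
Local Open Scope ring_scope.

(** The replacement move plays each vertex [v] that occurs in [m] exactly once,
    with the whole amount [x v] that [m] puts on it, so that even the cover
    functions after the two moves agree.  What has to be chosen is the order.
    Vertices that occur finitely often come first, sorted by their last
    occurrence; the vertices that recur infinitely often come afterwards, in
    any order.

    If [v] occurs for the last time at step [k], take the edge [E] that makes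
    step [k] of [m] legal.  All that the new move has put on [E] once it has
    played [v] was put there by [m] up to step [k], since the vertices before
    [v] do not occur after step [k]; so [E] works again.

    If [v] recurs, infinitely many steps of [m] at [v] are made legal by edges
    containing [v].  There are finitely many edges, so one edge [E] serves
    infinitely often.  Hence arbitrarily long partial sums of the amounts put on
    [E] fit below [1 - load t E], and so does the whole sum.  Whatever precedes
    [v] in the new move, [E] makes the step at [v] legal.

    Both cases are instances of one bound, [total_le_frequently], and are
    gathered in [exists_witness_key]. *)

(** * Amounts and totals of a move *)

(* Not the totality of a relation. *)
Local Notation total := Defs.total.

Definition nonneg_move (R : realType) (V : finType) (m : move R V) : Prop :=
  forall (k : nat) (u : V) (w : R), submove m k = Some (u, w) -> 0 <= w.

Definition occurs (R : realType) (V : finType) (m : move R V) (v : V)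
    (k : nat) : bool :=
  if submove m k is Some (u, _) then u == v else false.

Lemma valid_move_nonneg (R : realType) (V : finType) (H : hypergraph V)
    (t : V -> R) (m : move R V) : valid_move H t m -> nonneg_move m.
Proof. by case=> w01 _ _ k u w /w01 /andP[]. Qed.

Lemma amount_ge0 (R : realType) (V : finType) (m : move R V) (A : {pred V})
    (k : nat) : nonneg_move m -> 0 <= amount m A k.
Proof.
move=> m0; rewrite /amount; case E: (submove m k) => [[u w]|//].
by case: ifP => // _; apply: m0 E.
Qed.

Lemma amount_sum_pred1 (R : realType) (V : finType) (m : move R V)
    (A : {pred V}) (k : nat) :
  amount m A k = \sum_(v in A) amount m (pred1 v) k.
Proof.
rewrite /amount; case: (submove m k) => [[u w]|]; last by rewrite big1.
case: ifP => uA; last first.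
  by rewrite big1 // => v vA; rewrite inE; case: eqP => // uv; rewrite uv vA in uA.
rewrite (bigD1 u) //= inE eqxx big1 ?addr0 // => v /andP[_ vu].
by rewrite inE eq_sym (negPf vu).
Qed.

Lemma le_amount (R : realType) (V : finType) (m : move R V) (A B : {pred V})
    (k : nat) :
  nonneg_move m -> {subset A <= B} -> amount m A k <= amount m B k.
Proof.
move=> m0 AB; rewrite /amount; case E: (submove m k) => [[u w]|//].
case: ifP => [/AB -> //|_]; by case: ifP => // _; apply: m0 E.
Qed.

Lemma total_ge0 (R : realType) (V : finType) (m : move R V) (A : {pred V}) :
  nonneg_move m -> (0 <= total m A)%E.
Proof. by move=> m0; apply: nneseries_ge0 => k _ _; rewrite lee_fin amount_ge0. Qed.

Lemma total_sum_pred1 (R : realType) (V : finType) (m : move R V)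
    (A : {pred V}) :
  nonneg_move m -> total m A = (\sum_(v in A) total m (pred1 v))%E.
Proof.
move=> m0; rewrite /total -nneseries_sum; last first.
  by move=> *; rewrite lee_fin amount_ge0.
by apply: eq_eseriesr => k _; rewrite amount_sum_pred1 sumEFin.
Qed.

Lemma le_total (R : realType) (V : finType) (m : move R V) (A B : {pred V}) :
  nonneg_move m -> {subset A <= B} -> (total m A <= total m B)%E.
Proof.
move=> m0 AB; apply: lee_nneseries => k _.
  by rewrite lee_fin amount_ge0.
by rewrite lee_fin le_amount.
Qed.

(** Partial sums of nonnegative amounts increase, so bounding arbitrarily late
    ones bounds them all. *)
Lemma total_le_frequently (R : realType) (V : finType) (m : move R V)
    (A : {pred V}) (c : R) :
  nonneg_move m ->
  (forall n, exists2 N, (n <= N)%N & \sum_(0 <= k < N) amount m A k <= c) ->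
  (total m A <= c%:E)%E.
Proof.
move=> m0 bnd; apply: lime_le.
  by apply: is_cvg_nneseries => k _ _; rewrite lee_fin amount_ge0.
near=> n; rewrite sumEFin lee_fin; have [N nN] := bnd n.
apply: le_trans; rewrite [leRHS](@big_cat_nat _ _ _ n) //= lerDl.
by apply: sumr_ge0 => k _; apply: amount_ge0.
Unshelve. all: by end_near.
Qed.

Definition vertex_total (R : realType) (V : finType) (m : move R V) (v : V)
    : R :=
  fine (total m (pred1 v)).

Lemma total_vertex_total (R : realType) (V : finType) (m : move R V)
    (A : {pred V}) :
  nonneg_move m -> (total m predT <= 1)%E ->
  total m A = (\sum_(v in A) vertex_total m v)%:E.
Proof.
move=> m0 m1; rewrite total_sum_pred1 // -sumEFin; apply: eq_bigr => v _.
rewrite fineK // ge0_fin_numE ?total_ge0 //.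
by apply: le_lt_trans (ltry 1); apply: le_trans m1; apply: le_total.
Qed.

Lemma vertex_total_never (R : realType) (V : finType) (m : move R V) (v : V) :
  (forall k, ~~ occurs m v k) -> vertex_total m v = 0.
Proof.
move=> nv; rewrite /vertex_total /total eseries0 // => k _ _.
move: (nv k); rewrite /occurs /amount; case: (submove m k) => [[u w]|//].
by rewrite inE => /negPf ->.
Qed.

(** * Finite moves listing weighted vertices *)

Definition list_move (R : realType) (V : finType) (x : V -> R) (s : seq V)
    : move R V :=
  FinMove [seq (v, x v) | v <- s].

Lemma submove_list_move (R : realType) (V : finType) (x : V -> R) (s : seq V)
    (v0 : V) (k : nat) :
  submove (list_move x s) k =
    if (k < size s)%N then Some (nth v0 s k, x (nth v0 s k)) else None.
Proof.
rewrite /= onth_map; case: ltnP => ks; last by rewrite onth_default.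
by rewrite onthE (nth_map v0).
Qed.

Lemma submove_list_moveP (R : realType) (V : finType) (x : V -> R) (s : seq V)
    (k : nat) (u : V) (w : R) :
  submove (list_move x s) k = Some (u, w) ->
  [/\ (k < size s)%N, nth u s k = u & w = x u].
Proof.
by rewrite (submove_list_move _ _ u); case: ifP => // ks [-> <-].
Qed.

Lemma list_move_distinct (R : realType) (V : finType) (x : V -> R)
    (s : seq V) :
  uniq s -> vertices_distinct (list_move x s).
Proof.
move=> us j k u w w' /submove_list_moveP[js ju _] /submove_list_moveP[ks ku _].
by apply/eqP; rewrite -(nth_uniq u js ks us) ju ku.
Qed.

Lemma sum_amount_list_move (R : realType) (V : finType) (x : V -> R)
    (s : seq V) (A : {pred V}) (n : nat) :
  \sum_(0 <= k < n) amount (list_move x s) A k =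
    \sum_(v <- take n s | v \in A) x v.
Proof.
elim: n => [|n IHn]; first by rewrite take0 big_geq // big_nil.
rewrite big_nat_recr //= IHn; case: (ltnP n (size s)) => ns; last first.
  rewrite !take_oversize // ?(leqW ns) // /amount /= onth_map onth_default //=.
  by rewrite addr0.
have [v0 _] : exists v : V, true by case: s ns {IHn} => // v; exists v.
rewrite (take_nth v0 ns) -cats1 big_cat /= big_cons big_nil.
by rewrite /amount (submove_list_move _ _ v0) ns addr0.
Qed.

Lemma total_list_move (R : realType) (V : finType) (x : V -> R) (s : seq V)
    (A : {pred V}) :
  total (list_move x s) A = (\sum_(v <- s | v \in A) x v)%:E.
Proof.
apply: lim_near_cst => //.
exists (size s) => // n /= sn.
by rewrite sumEFin sum_amount_list_move take_oversize.
Qed.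

(** * Ordering the vertices *)

Definition recurrent (R : realType) (V : finType) (m : move R V) (v : V)
    : Prop :=
  forall n, exists2 k, (n <= k)%N & occurs m v k.

(** The key of a vertex that occurs finitely often is its last occurrence;
    recurrent vertices share a key above all of those. *)
Lemma exists_last_occurrence_key (R : realType) (V : finType) (m : move R V) :
  exists key : V -> nat, forall v k, occurs m v k ->
    recurrent m v \/
    occurs m v (key v) /\
      forall u j, (key u <= key v)%N -> occurs m u j -> (j <= key v)%N.
Proof.
have last_ex v : exists l, ~ recurrent m v -> forall k, occurs m v k ->
    occurs m v l /\ forall j, occurs m v j -> (j <= l)%N.
  have [rv|nrv] := pselect (recurrent m v); first by exists 0%N.
  have [[k vk]|nv] := pselect (exists k, occurs m v k); last first.
    by exists 0%N => _ k vk; case: nv; exists k.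
  have [n bn] : exists n, forall j, occurs m v j -> (j <= n)%N.
    apply: contrapT => nb; apply: nrv => n; apply: contrapT => h; apply: nb.
    exists n => j vj; case: (leqP j n) => // nj; case: h.
    by exists j => //; apply: ltnW.
  have ex : exists k, occurs m v k by exists k.
  by case: (ex_maxnP ex bn) => l vl ml; exists l => _ _ _.
have [last lastP] := choice last_ex.
exists (fun v => if `[< recurrent m v >] then (\max_u last u).+1 else last v).
move=> v k vk; have [rv|nrv] := pselect (recurrent m v); first by left.
right; have [vl _] := lastP v nrv k vk.
rewrite [`[< recurrent m v >]]asboolF //; split=> // u j.
case: asboolP => [_|nru uv uj].
  by rewrite ltnNge leq_bigmax.
by have [_ /(_ j uj)/leq_trans] := lastP u nru j uj; apply.
Qed.

(** The pigeonhole principle: finitely many values cannot each be taken only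
    boundedly often along infinitely many steps. *)
Lemma frequent_value (T : finType) (P : T -> nat -> Prop) :
  (forall n, exists2 k, (n <= k)%N & exists x, P x k) ->
  exists x, forall n, exists2 k, (n <= k)%N & P x k.
Proof.
move=> Pfreq; apply: contrapT => nfreq.
have bnd x : exists n, forall k, (n <= k)%N -> ~ P x k.
  apply: contrapT => nb; apply: nfreq; exists x => n; apply: contrapT => h.
  by apply: nb; exists n => k nk Pxk; apply: h; exists k.
have [b bP] := choice bnd.
have [k bk [x Pxk]] := Pfreq (\max_x b x)%N.
by apply: (bP x k) Pxk; apply: leq_trans bk; apply: leq_bigmax.
Qed.

(** The edge found for [v] leaves room for the full amounts of all vertices
    placed no later than [v]. *)
Lemma exists_witness_key (R : realType) (V : finType) (H : hypergraph V)
    (t : V -> R) (m : move R V) :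
  legal_move H t m ->
  exists key : V -> nat, forall v k, occurs m v k ->
    exists E : {set V}, [/\ E \in edges H, v \in E
      & (total m [pred u | (u \in E) && (key u <= key v)%N]
           <= (1 - load t E)%:E)%E].
Proof.
case=> _ /valid_move_nonneg m0 leg.
have legE v k : occurs m v k -> exists E : {set V}, [/\ E \in edges H, v \in E
    & \sum_(0 <= s < k.+1) amount m E s <= 1 - load t E].
  rewrite /occurs; case Ek: (submove m k) => [[u w]|//] /eqP uv; subst u.
  have [E [EH vE h]] := leg _ _ _ Ek; exists E; split=> //.
  by rewrite lerBrDl big_nat_recr //= addrA {2}/amount Ek vE.
have [key keyP] := exists_last_occurrence_key m.
exists key => v k /keyP[rv|[vl before]].
  have [E EP] : exists E : {set V}, forall n, exists2 k, (n <= k)%N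
      & [/\ E \in edges H, v \in E
          & \sum_(0 <= s < k.+1) amount m E s <= 1 - load t E].
    apply: frequent_value => n; have [j nj vj] := rv n.
    by exists j => //; apply: legE.
  have [_ _ [EH vE _]] := EP 0%N; exists E; split=> //.
  apply: (@le_trans _ _ (total m E)).
    by apply: le_total => // u /andP[].
  apply: total_le_frequently => // n; have [j nj [_ _ h]] := EP n.
  by exists j.+1 => //; apply: leqW.
have [E [EH vE h]] := legE _ _ vl; exists E; split=> //.
apply: total_le_frequently => // n.
exists (maxn n (key v).+1); first exact: leq_maxl.
apply: le_trans h; rewrite (@big_cat_nat _ _ _ (key v).+1) ?leq_maxr //=.
(* No vertex with key at most [key v] is played after step [key v]. *)
rewrite [X in _ + X]big_nat_cond [X in _ + X]big1 ?addr0; last first.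
  move=> s; rewrite andbT => /andP[vs _]; rewrite /amount.
  case Es: (submove m s) => [[u w]|//]; case: ifP => // /andP[_ uv].
  have us : occurs m u s by rewrite /occurs Es.
  by have := before u s uv us; rewrite leqNgt vs.
by apply: ler_sum => s _; apply: le_amount => // u /andP[].
Qed.

(** * The replacement *)

(** In a list sorted by key, a prefix only holds vertices with keys at most
    that of its last element, and each of them once. *)
Lemma sum_take_sorted_le (R : numDomainType) (V : finType) (key : V -> nat)
    (x : V -> R) (s : seq V) (A : {pred V}) (v : V) (k : nat) :
  (forall u, 0 <= x u) -> uniq s -> sorted (relpre key leq) s ->
  (k < size s)%N -> nth v s k = v ->
  \sum_(u <- take k.+1 s | u \in A) x u
    <= \sum_(u in [pred u | (u \in A) && (key u <= key v)%N]) x u.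
Proof.
move=> x0 us ss ks kv; rewrite big_mkcond /= big_uniq ?take_uniq //=.
rewrite -big_mkcondr /= big_mkcond [leRHS]big_mkcond; apply: ler_sum => u _.
case: ifP => [/andP[uk uA]|_]; last by case: ifP.
suff uv : (key u <= key v)%N by rewrite inE uA uv.
move: uk => /(nthP v)[j]; rewrite size_takel // ltnS => jk.
rewrite nth_take // => <-; rewrite -[in leqRHS]kv.
have tr : transitive (relpre key leq) by move=> a b c; apply: leq_trans.
apply: (sorted_leq_nth tr _ v ss) => //; first by move=> a /=.
by rewrite inE (leq_ltn_trans jk ks).
Qed.

Theorem theorem6 (R : realType) (V : finType) (H : hypergraph V)
    (t : V -> R) (m : move R V) :
  game_cover H t -> legal_move H t m ->
  exists m' : move R V,
    [/\ legal_move H t m', vertices_distinct m'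
      & forall E : {set V}, E \in edges H ->
          load (play t m') E = load (play t m) E].
Proof.
move=> _ leg; have [nfin valid _] := leg.
have [w01 m1 mlast] := valid; have m0 := valid_move_nonneg valid.
have [key keyP] := exists_witness_key leg.
pose x := vertex_total m.
have x0 v : 0 <= x v by apply: fine_ge0; apply: total_ge0.
have totalE A := total_vertex_total A m0 m1.
pose s := sort (relpre key leq) [seq v <- enum V | `[< exists k, occurs m v k >]].
have us : uniq s by rewrite sort_uniq filter_uniq ?enum_uniq.
have ss : sorted (relpre key leq) s.
  by apply: sort_sorted => u v; apply: leq_total.
have sP v : v \in s -> exists k, occurs m v k.
  by rewrite mem_sort mem_filter => /andP[/asboolP].
have xs v : v \notin s -> x v = 0.
  rewrite mem_sort mem_filter mem_enum andbT => /asboolPn nv.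
  by apply: vertex_total_never => k; apply/negP => vk; apply: nv; exists k.
have total' A : total (list_move x s) A = total m A.
  rewrite total_list_move totalE; congr _%:E.
  rewrite big_mkcond big_uniq //= [RHS]big_mkcond [LHS]big_mkcond /=.
  apply: eq_bigr => v _; rewrite -/(x v).
  by case: (boolP (v \in s)) => // /xs ->; case: ifP.
have play' : play t (list_move x s) = play t m.
  by apply/funext => v; rewrite /play total'.
exists (list_move x s); split; last 2 first.
- exact: list_move_distinct.
- by rewrite play'.
split=> // [|k u w /submove_list_moveP[ks ku ->]].
  split; rewrite ?play' ?total' // => k u w /submove_list_moveP[_ _ ->].
  rewrite x0 /=; move: m1; rewrite totalE lee_fin; apply: le_trans.
  by rewrite (bigD1 u) //= lerDl sumr_ge0.
have [j uj] : exists j, occurs m u j by apply: sP; rewrite -ku mem_nth.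
have [E [EH uE]] := keyP u j uj.
rewrite totalE lee_fin lerBrDl => h; exists E; split=> //.
apply: le_trans h; rewrite -addrA lerD2l.
apply: le_trans (sum_take_sorted_le _ x0 us ss ks ku).
rewrite sum_amount_list_move (take_nth u ks) -cats1 big_cat /=.
by rewrite big_cons big_nil ku uE addr0.
Qed.
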